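(* Let $H_1,H_2\in(\tfrac12,1)$, let $B^{H_1}$ and $B^{H_2}$ be two independent fractional Brownian motions with Hurst indices $H_1$ and $H_2$, and let $\theta\in\mathbb R$. Consider the model $$X_t=\theta t+B^{H_1}_t+B^{H_2}_t,\qquad t\ge 0,$$ observed at the points $0<t_1<t_2<\ldots<t_N$, and let $\hat\theta^{(N)}$ be the discrete-time maximum likelihood estimator of $\theta$ (defined in the context). If $t_N\to+\infty$ as $N\to\infty$, then $\hat\theta^{(N)}$ is $L_2$-consistent and strongly consistent, i.e. $\hat\theta^{(N)}\to\theta$ in $L_2(\Omega)$ and almost surely as $N\to\infty$.
   Context: A fractional Brownian motion with Hurst index $H\in(0,1)$ is a centered Gaussian process $B^H=\{B^H_t,\,t\ge0\}$ with $B^H_0=0$ and covariance $\mathsf E B^H_tB^H_s=\frac12\left(t^{2H}+s^{2H}-|t-s|^{2H}\right)$. Here $(t_k)_{k\ge1}$ is a strictly increasing sequence of positive reals and, for each $N$, the observations are $X_{t_1},\dots,X_{t_N}$. Put $B_t=B^{H_1}_t+B^{H_2}_t$ and $$\Delta X^{(N)}=(X_{t_1},X_{t_2}-X_{t_1},\ldots,X_{t_N}-X_{t_{N-1}})^\top,$$ $$\Delta B^{(N)}=(B_{t_1},B_{t_2}-B_{t_1},\ldots,B_{t_N}-B_{t_{N-1}})^\top,$$ $$\Delta G^{(N)}=(t_1,t_2-t_1,\ldots,t_N-t_{N-1})^\top,$$ and let $\Gamma^{(N)}$ be the covariance matrix of $\Delta B^{(N)}$ (it is nonsingular). The discrete-time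 MLE is $$\hat\theta^{(N)}=\frac{(\Delta G^{(N)})^\top(\Gamma^{(N)})^{-1}\Delta X^{(N)}}{(\Delta G^{(N)})^\top(\Gamma^{(N)})^{-1}\Delta G^{(N)}}.$$ *)

(* Defs.v *)
From HB Require Import structures.
From mathcomp Require Import all_boot all_order all_algebra.
From mathcomp Require Import all_classical all_reals all_analysis.

Set Implicit Arguments.
Unset Strict Implicit.
Unset Printing Implicit Defensive.

Import Order.TTheory GRing.Theory Num.Theory.
Import numFieldNormedType.Exports.

Local Open Scope classical_set_scope.
Local Open Scope ring_scope.

(* A process indexed by [0, +oo[ is a family of random variables indexed by
   all of R; every condition below only involves indices t >= 0. *)

(* [normal_prob m 0] is the uniform law on [0, 1], so the degenerate normal
   law is spelled out as a Dirac mass. *)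
Definition gaussian_law (R : realType) (m s : R) (A : set R) : \bar R :=
  if s == 0 then dirac m A else normal_prob m s A.

Definition gaussian_rv d (T : measurableType d) (R : realType)
    (P : probability T R) (Y : T -> R) : Prop :=
  measurable_fun setT Y /\
  exists m s : R, forall A : set R, measurable A ->
    P (Y @^-1` A) = gaussian_law m s A.

(* Joint normality of the finite-dimensional distributions, in the form
   "every finite linear combination is normal". *)
Definition gaussian_process d (T : measurableType d) (R : realType)
    (P : probability T R) (B : R -> {RV P >-> R}) : Prop :=
  forall (n : nat) (t a : 'I_n -> R), (forall i, 0 <= t i) ->
    gaussian_rv P (fun w => \sum_(i < n) a i * B (t i) w).
Arguments gaussian_process {d T R} P B.

Definition fBm d (T : measurableType d) (R : realType)
    (P : probability T R) (H : R) (B : R -> {RV P >-> R}) : Prop :=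
  [/\ gaussian_process P B,
      forall t : R, 0 <= t -> ('E_P[B t] = 0)%E,
      {ae P, forall w, B 0 w = 0} &
      forall t s : R, 0 <= t -> 0 <= s ->
        ('E_P[fun w => (B t w * B s w)%R])%E =
          (2^-1 * (t `^ (2 * H) + s `^ (2 * H) - `|t - s| `^ (2 * H)))%:E].
Arguments fBm {d T R} P H B.

Definition process_sigma_algebra d (T : measurableType d) (R : realType)
    (B : R -> T -> R) : set (set T) :=
  <<s \bigcup_(t in [set t : R | 0 <= t])
        preimage_set_system setT (B t) measurable >>.

Definition independent_processes d (T : measurableType d) (R : realType)
    (P : probability T R) (B1 B2 : R -> {RV P >-> R}) : Prop :=
  forall C1 C2 : set T,
    process_sigma_algebra B1 C1 -> process_sigma_algebra B2 C2 ->
    P (C1 `&` C2) = (P C1 * P C2)%E.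
Arguments independent_processes {d T R} P B1 B2.

(* The observation times t_1 < t_2 < ... are numbered from 0: [t k] is
   t_(k+1), so that the first N times are [t i] for i < N.
   [increment t f] is (f(t_1), f(t_2) - f(t_1), f(t_3) - f(t_2), ...). *)
Definition increment (R : realType) (t : nat -> R) (f : R -> R) (i : nat) : R :=
  if i is j.+1 then f (t i) - f (t j) else f (t 0%N).

Definition increments (R : realType) (t : nat -> R) (N : nat) (f : R -> R) :
    'cV[R]_N :=
  \col_(i < N) increment t f i.

Definition increments_cov d (T : measurableType d) (R : realType)
    (P : probability T R) (t : nat -> R) (N : nat) (B : R -> T -> R) :
    'M[R]_N :=
  \matrix_(i < N, j < N)
    fine (covariance P (fun w => increment t (B^~ w) i)
                       (fun w => increment t (B^~ w) j)).

Definition mle d (T : measurableType d) (R : realType)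
    (P : probability T R) (t : nat -> R) (N : nat) (B X : R -> T -> R)
    (w : T) : R :=
  let G := increments t N id in
  let Gamma := increments_cov P t N B in
  (G^T *m invmx Gamma *m increments t N (X^~ w)) 0 0 /
  (G^T *m invmx Gamma *m G) 0 0.

Definition cvg_in_L2 d (T : measurableType d) (R : realType)
    (P : probability T R) (Y : nat -> T -> R) (Z : T -> R) : Prop :=
  [/\ forall n, Y n \in Lfun P 2%:E, Z \in Lfun P 2%:E &
      ('E_P[fun w => ((Y n w - Z w) ^+ 2)%R])%E @[n --> \oo] --> 0%E].

Definition cvg_as d (T : measurableType d) (R : realType)
    (P : probability T R) (Y : nat -> T -> R) (Z : T -> R) : Prop :=
  {ae P, forall w, Y n w @[n --> \oo] --> Z w}.

(* Main.v *)
Require Import Defs.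
From HB Require Import structures.
From mathcomp Require Import all_boot all_order all_algebra.
From mathcomp Require Import all_classical all_reals all_analysis.
From mathcomp Require Import measurable_realfun ring lra.

(* The error [Y_N] of the estimator is the combination [sum_i c_i D_i] of the
   increments [D_i] of [B] such that [sum_i c_i G_i = 1] and
   [E(Y_N D_j) = v_N G_j] for all [j], where [v_N = E(Y_N^2)]. Hence
   [E(Y_n Y_m) = v_n] for [m <= n], so that [E((Y_n - Y_m)^2) = v_m - v_n]; and
   [v_N] is at most the variance of the unbiased estimator [B_(t_N) / t_N],
   which tends to 0: this is L2-consistency.

   For a linear combination [L] of values of [B], [E(L^4) <= C (E(L^2))^2]: this
   holds for the two Gaussian parts of [L], and their second moments add up.
   Therefore [E((Y_n - Y_m)^4) <= C (v_m - v_n)^2], and as the exponent 2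
   exceeds 1 a bisection argument bounds [E(max_(m <= k <= n) (Y_k - Y_m)^4)]
   by a multiple of [(v_m - v_n)^2]. So [E(sup_(k >= m) Y_k^4) = O(v_m^2)] and
   [limsup |Y_k| = 0] almost surely. No independence of Gaussian increments is
   used.

   The covariance matrix is invertible because a combination
   [sum_k a_k B1_(t_k)] of null variance is orthogonal to every [B1_s], i.e.
   [sum_k a_k (t_k^2H + s^2H - |t_k - s|^2H) = 0] for all [s >= 0], and the
   second difference of the left-hand side at [s = t_j] isolates [a_j], as
   [2H < 2]. *)

Import Order.TTheory GRing.Theory Num.Theory.
Import numFieldNormedType.Exports.

Local Open Scope classical_set_scope.
Local Open Scope ring_scope.

(** * Elementary inequalities for squares and fourth powers *)

Section inequalities.
Context {R : realType}.
Implicit Types a b : R.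

Lemma sqrD_le a b : (a + b) ^+ 2 <= 2 * a ^+ 2 + 2 * b ^+ 2.
Proof. by have := sqr_ge0 (a - b); rewrite !expr2; lra. Qed.

Lemma pow4D_le a b : (a + b) ^+ 4 <= 8 * a ^+ 4 + 8 * b ^+ 4.
Proof.
have h1 := sqrD_le a b; have h2 := sqrD_le (a ^+ 2) (b ^+ 2).
have -> : (a + b) ^+ 4 = ((a + b) ^+ 2) ^+ 2 by rewrite -exprM.
have h3 : ((a + b) ^+ 2) ^+ 2 <= (2 * a ^+ 2 + 2 * b ^+ 2) ^+ 2.
  by rewrite ler_sqr ?nnegrE ?addr_ge0 ?sqr_ge0 // mulr_ge0 // sqr_ge0.
apply: (le_trans h3).
have -> : (2 * a ^+ 2 + 2 * b ^+ 2) ^+ 2 = 4 * (a ^+ 2 + b ^+ 2) ^+ 2 by ring.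
move: h2; rewrite -!exprM; lra.
Qed.

(* [(a + b)^2 <= (5/4) a^2 + 5 b^2] squared. That the constant in front of
   [a^4] is below 3 is what lets the bisection in [integral_max_dev4_le]
   close: [(1 + 2) / 4 < 1]. *)
Lemma pow4D_le2 a b : (a + b) ^+ 4 <= 2 * a ^+ 4 + 125 * b ^+ 4.
Proof.
have E (x : R) : x ^+ 4 = (x ^+ 2) ^+ 2 by rewrite -exprM.
have h1 : (a + b) ^+ 2 <= 5 / 4 * a ^+ 2 + 5 * b ^+ 2.
  by have := sqr_ge0 (a - 4 * b); rewrite !expr2; lra.
have h2 : (5 / 4 * a ^+ 2 + 5 * b ^+ 2) ^+ 2 <=
    5 / 4 * (5 / 4 * a ^+ 2) ^+ 2 + 5 * (5 * b ^+ 2) ^+ 2.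
  by have := sqr_ge0 (5 / 4 * a ^+ 2 - 4 * (5 * b ^+ 2)); rewrite !expr2; lra.
have h3 : ((a + b) ^+ 2) ^+ 2 <= (5 / 4 * a ^+ 2 + 5 * b ^+ 2) ^+ 2.
  by rewrite ler_sqr ?nnegrE ?addr_ge0 ?sqr_ge0 // mulr_ge0 //
    ?sqr_ge0 // divr_ge0.
rewrite !E; apply: (le_trans h3); apply: (le_trans h2).
have := sqr_ge0 (a ^+ 2); rewrite !exprMn; lra.
Qed.

End inequalities.

(** * Second and fourth moments of a normal law *)

Section normal_moments.
Context {R : realType}.
Implicit Types (m s x : R).
Local Notation mu := lebesgue_measure.

(** The Radon-Nikodym derivative of [normal_prob] agrees almost everywhere with [normal_pdf], since
    both have the same integral over every measurable set. *)
Lemma ge0_integral_normal_prob m s (f : R -> \bar R) :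
  measurable_fun [set: R] f -> (forall x, (0 <= f x)%E) ->
  (\int[normal_prob m s]_x f x = \int[mu]_x (f x * (normal_pdf m s x)%:E))%E.
Proof.
move=> mf f0.
have dom := @normal_prob_dominates R m s.
rewrite -(Radon_Nikodym_SigmaFinite.change_of_variables dom)//.
have intRN := Radon_Nikodym_SigmaFinite.f_integrable dom.
have mpdf : measurable_fun [set: R] (fun x : R => (normal_pdf m s x)%:E).
  by apply/measurable_EFinP; exact: measurable_normal_pdf.
apply: ae_eq_integral => //.
- apply: emeasurable_funM => //; exact: measurable_int intRN.
- exact: emeasurable_funM.
apply: ae_eqe_mul2l.
apply: integral_ae_eq => // E _ mE.
by rewrite -Radon_Nikodym_SigmaFinite.f_integral.
Qed.

Lemma normal_peakZ k s : 0 < k -> normal_peak (k * s) = k^-1 * normal_peak s.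
Proof.
move=> k0; rewrite /normal_peak.
have -> : (k * s) ^+ 2 * pi *+ 2 = k ^+ 2 * (s ^+ 2 * pi *+ 2) by ring.
by rewrite sqrtrM ?sqr_ge0// sqrtr_sqr ger0_norm ?ltW// invfM.
Qed.

Lemma integral_normal_pdfZ a m s : 0 <= a ->
  (\int[mu]_x (a * normal_pdf m s x)%:E = a%:E)%E.
Proof.
move=> a0; under eq_integral do rewrite EFinM.
rewrite ge0_integralZl//=; first by rewrite integral_normal_pdf mule1.
- by apply/measurable_EFinP; exact: measurable_normal_pdf.
- by move=> x _; rewrite lee_fin normal_pdf_ge0.
Qed.

Lemma measurable_normal_pdfZ a m s :
  measurable_fun [set: R] (fun x => (a * normal_pdf m s x)%:E).
Proof.
by apply/measurable_EFinP/measurable_funM => //; exact: measurable_normal_pdf.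
Qed.

Lemma integral_normal_pdfDZ a m1 s1 b m2 s2 : 0 <= a -> 0 <= b ->
  (\int[mu]_x (a * normal_pdf m1 s1 x + b * normal_pdf m2 s2 x)%:E
   = (a + b)%:E)%E.
Proof.
move=> a0 b0; under eq_integral do rewrite EFinD.
rewrite ge0_integralD//=; first by rewrite !integral_normal_pdfZ.
- by move=> x _; rewrite lee_fin mulr_ge0// normal_pdf_ge0.
- exact: measurable_normal_pdfZ.
- by move=> x _; rewrite lee_fin mulr_ge0// normal_pdf_ge0.
- exact: measurable_normal_pdfZ.
Qed.

(** Moments are bounded without being computed: a pointwise comparison with a mixture of normal
    densities suffices, each density having mass 1. *)
Lemma integral_normal_prob_le m s (f : R -> R) a m1 s1 b m2 s2 :
  measurable_fun [set: R] f -> (forall x, 0 <= f x) -> 0 <= a -> 0 <= b ->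
  (forall x, f x * normal_pdf m s x <=
             a * normal_pdf m1 s1 x + b * normal_pdf m2 s2 x) ->
  (\int[normal_prob m s]_x (f x)%:E <= (a + b)%:E)%E.
Proof.
move=> mf f0 a0 b0 le; rewrite ge0_integral_normal_prob; last 2 first.
- exact/measurable_EFinP.
- by move=> x; rewrite lee_fin.
rewrite -(integral_normal_pdfDZ a m1 s1 b m2 s2)//.
apply: ge0_le_integral => //.
- by move=> x _; rewrite mule_ge0// lee_fin// normal_pdf_ge0.
- apply: emeasurable_funM; apply/measurable_EFinP => //.
  exact: measurable_normal_pdf.
- apply/measurable_EFinP/measurable_funD; apply: measurable_funM => //;
  exact: measurable_normal_pdf.
- by move=> x _; rewrite -EFinM lee_fin.
Qed.

(** The correcting density stands on the larger side, so that only integrals of nonnegative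
    functions occur. *)
Lemma integral_normal_prob_ge m s (f : R -> R) c a m1 s1 :
  measurable_fun [set: R] f -> (forall x, 0 <= f x) -> 0 <= a -> 0 <= c ->
  (forall x, c * normal_pdf m s x <=
             f x * normal_pdf m s x + a * normal_pdf m1 s1 x) ->
  (c%:E <= \int[normal_prob m s]_x (f x)%:E + a%:E)%E.
Proof.
move=> mf f0 a0 c0 le; rewrite ge0_integral_normal_prob; last 2 first.
- exact/measurable_EFinP.
- by move=> x; rewrite lee_fin.
have mfp : measurable_fun [set: R]
    (fun x => ((f x)%:E * (normal_pdf m s x)%:E)%E).
  apply: emeasurable_funM; apply/measurable_EFinP => //.
  exact: measurable_normal_pdf.
rewrite -(integral_normal_pdfZ c m s c0) -(integral_normal_pdfZ a m1 s1 a0).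
rewrite -ge0_integralD//=; last 3 first.
- by move=> x _; rewrite mule_ge0// lee_fin// normal_pdf_ge0.
- by move=> x _; rewrite lee_fin mulr_ge0// normal_pdf_ge0.
- exact: measurable_normal_pdfZ.
apply: ge0_le_integral => //.
- by move=> x _; rewrite lee_fin mulr_ge0// normal_pdf_ge0.
- exact: measurable_normal_pdfZ.
- by apply: emeasurable_funD => //; exact: measurable_normal_pdfZ.
- by move=> x _; rewrite -EFinM -EFinD lee_fin.
Qed.

(** Doubling the standard deviation leaves a Gaussian factor, which absorbs polynomial growth in
    [x - m]. *)
Lemma normal_pdf_double m s x : s != 0 ->
  normal_pdf m s x =
  2 * normal_pdf m (2 * s) x * expR (- (3 * (x - m) ^+ 2 / (8 * s ^+ 2))).
Proof.
move=> s0; rewrite !normal_pdfE ?mulf_neq0//= normal_peakZ// /normal_fun.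
have E (p a b : R) : 2 * (2^-1 * p * a) * b = p * (a * b) by field.
rewrite E -expRD; congr (_ * expR _).
by field; rewrite s0.
Qed.

Lemma normal_pdf_sqr_le m s x : s != 0 ->
  (x - m) ^+ 2 * normal_pdf m s x <= 8 * s ^+ 2 * normal_pdf m (2 * s) x.
Proof.
move=> s0; rewrite normal_pdf_double//.
set p := normal_pdf _ _ _; have p0 : 0 <= p by exact: normal_pdf_ge0.
set z := 3 * (x - m) ^+ 2 / (8 * s ^+ 2).
have s2 : 0 < s ^+ 2 by rewrite exprn_even_gt0.
have -> : (x - m) ^+ 2 = 8 / 3 * s ^+ 2 * z by rewrite /z; field.
have z1 : z * expR (- z) <= 1.
  rewrite expRN ler_pdivrMr ?expR_gt0// mul1r.
  by have := expR_ge1Dx z; lra.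
have sp : 0 <= s ^+ 2 * p by rewrite mulr_ge0// ltW.
by have := ler_wpM2l sp z1; lra.
Qed.

Lemma normal_pdf_pow4_le m s x : s != 0 ->
  (x - m) ^+ 4 * normal_pdf m s x <= 64 * s ^+ 4 * normal_pdf m (2 * s) x.
Proof.
move=> s0; rewrite normal_pdf_double//.
set p := normal_pdf _ _ _; have p0 : 0 <= p by exact: normal_pdf_ge0.
set z := 3 * (x - m) ^+ 2 / (8 * s ^+ 2).
have s2 : 0 < s ^+ 2 by rewrite exprn_even_gt0.
have s4 : 0 < s ^+ 4 by rewrite exprn_even_gt0.
have -> : (x - m) ^+ 4 = 64 / 9 * s ^+ 4 * z ^+ 2 by rewrite /z; field.
have z0 : 0 <= z by rewrite /z divr_ge0 // mulr_ge0 // sqr_ge0.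
(* This is [z / 2 <= expR (z / 2)], squared. *)
have z1 : z ^+ 2 * expR (- z) <= 4.
  rewrite expRN ler_pdivrMr ?expR_gt0//.
  have -> : expR z = expR (z / 2) ^+ 2 by rewrite expr2 -expRD -splitr.
  have h := expR_ge1Dx (z / 2).
  have -> : 4 * expR (z / 2) ^+ 2 = (2 * expR (z / 2)) ^+ 2 by ring.
  by rewrite ler_sqr ?nnegrE//; lra.
have sp : 0 <= s ^+ 4 * p by rewrite mulr_ge0// ltW.
by have := ler_wpM2l sp z1; lra.
Qed.

(* By [1 - z <= exp (- z)] with [z = 2 x^2 / s^2]; when [normal_pdf m s] is
   bounded by its peak, [exp (- z)] becomes a multiple of the density of
   half the standard deviation. *)
Lemma normal_pdf_sqr_ge m s x : s != 0 ->
  s ^+ 2 / 2 * normal_pdf m s x <=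
  x ^+ 2 * normal_pdf m s x + s ^+ 2 / 4 * normal_pdf 0 (2^-1 * s) x.
Proof.
move=> s0; have s2 : 0 < s ^+ 2 by rewrite exprn_even_gt0.
have -> : normal_pdf 0 (2^-1 * s) x =
    2 * normal_peak s * expR (- (2 * x ^+ 2 / s ^+ 2)).
  rewrite normal_pdfE ?mulf_neq0//= normal_peakZ ?invr_gt0// invrK.
  by rewrite /normal_fun; congr (_ * expR _); field.
set z := 2 * x ^+ 2 / s ^+ 2.
have -> : x ^+ 2 = s ^+ 2 / 2 * z by rewrite /z; field.
have h := normal_pdf_ub m x s0.
have p0 := normal_pdf_ge0 m s x.
have h2 : (1 - z) * normal_pdf m s x <= normal_peak s * expR (- z).
  apply: (@le_trans _ _ (expR (- z) * normal_pdf m s x)).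
    by rewrite ler_wpM2r//; exact: expR_ge1Dx.
  by rewrite mulrC ler_wpM2r ?expR_ge0.
rewrite -lerBlDl -mulrBl -[X in X - _]mulr1 -mulrBr -mulrA.
rewrite (_ : _ / 4 * _ = s ^+ 2 / 2 * (normal_peak s * expR (- z)));
  last by field.
by rewrite ler_wpM2l// divr_ge0// ltW.
Qed.

(* 210 comes from the crude density bounds above (the optimal constant is
   [sqrt 3] for a centered law); only its existence matters. *)
Lemma normal_moments m s : s != 0 -> exists a : R,
  (\int[normal_prob m s]_x (x ^+ 2)%:E = a%:E)%E /\
  (\int[normal_prob m s]_x (x ^+ 4)%:E <= ((210 * a) ^+ 2)%:E)%E.
Proof.
move=> s0.
have s2 : 0 < s ^+ 2 by rewrite exprn_even_gt0.
have s4 : 0 < s ^+ 4 by rewrite exprn_even_gt0.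
have m4 : 0 <= m ^+ 4 by rewrite exprn_even_ge0.
have m2 := sqr_ge0 m.
have mX k : measurable_fun [set: R] (fun x : R => x ^+ k).
  exact: measurable_funX.
have sq0 (x : R) : 0 <= x ^+ 2 by exact: sqr_ge0.
have pow4_0 (x : R) : 0 <= x ^+ 4 by rewrite exprn_even_ge0.
have up2 : (\int[normal_prob m s]_x (x ^+ 2)%:E <=
    (16 * s ^+ 2 + 2 * m ^+ 2)%:E)%E.
  apply: (@integral_normal_prob_le _ _ (fun x : R => x ^+ 2)
    _ m (2 * s) _ m s) => //; try lra.
  move=> x; have := normal_pdf_sqr_le m s x s0; have p0 := normal_pdf_ge0 m s x.
  have := ler_wpM2r p0 (sqrD_le (x - m) m); rewrite subrK; lra.
have up4 : (\int[normal_prob m s]_x (x ^+ 4)%:E <=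
    (8 * (64 * s ^+ 4) + 8 * m ^+ 4)%:E)%E.
  apply: (@integral_normal_prob_le _ _ (fun x : R => x ^+ 4)
    (8 * (64 * s ^+ 4)) m (2 * s) (8 * m ^+ 4) m s) => //; try lra.
  move=> x; have := normal_pdf_pow4_le m s x s0.
  have p0 := normal_pdf_ge0 m s x.
  by have := ler_wpM2r p0 (pow4D_le (x - m) m); rewrite subrK; lra.
have lo1 : ((s ^+ 2 / 2)%:E <=
    \int[normal_prob m s]_x (x ^+ 2)%:E + (s ^+ 2 / 4)%:E)%E.
  apply: (@integral_normal_prob_ge _ _ (fun x : R => x ^+ 2)
    _ _ 0 (2^-1 * s)) => //; try lra.
  by move=> x; exact: normal_pdf_sqr_ge.
have lo2 : ((m ^+ 2 / 2)%:E <=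
    \int[normal_prob m s]_x (x ^+ 2)%:E + (8 * s ^+ 2)%:E)%E.
  apply: (@integral_normal_prob_ge _ _ (fun x : R => x ^+ 2)
    _ _ m (2 * s)) => //; try lra.
  move=> x; have := normal_pdf_sqr_le m s x s0; have p0 := normal_pdf_ge0 m s x.
  have := ler_wpM2r p0 (sqrD_le x (m - x)); rewrite addrC subrK.
  rewrite -(opprB x m) sqrrN; lra.
have a_fin : (\int[normal_prob m s]_x (x ^+ 2)%:E)%E \is a fin_num.
  rewrite ge0_fin_numE; first exact: le_lt_trans up2 (ltry _).
  by apply: integral_ge0 => x _; rewrite lee_fin.
exists (fine (\int[normal_prob m s]_x (x ^+ 2)%:E)%E).
rewrite fineK//; split => //; apply: (le_trans up4).
move: up2 lo1 lo2; rewrite -(fineK a_fin) -!EFinD !lee_fin.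
set a := fine _ => up2 lo1 lo2.
(* [lo1] gives [s^2 <= 4 a], and then [lo2] gives [m^2 <= 2 a + 16 s^2 <= 66 a]. Inserted in [up4],
   this yields the factor [512 * 16 + 8 * 66^2 = 43040], which is below [210^2]. *)
have s_a : s ^+ 2 <= 4 * a by lra.
have m_a : m ^+ 2 <= 66 * a by lra.
have s4a : s ^+ 4 <= 16 * a ^+ 2.
  have -> : s ^+ 4 = (s ^+ 2) ^+ 2 by rewrite -exprM.
  have -> : 16 * a ^+ 2 = (4 * a) ^+ 2 by ring.
  by rewrite ler_sqr ?nnegrE//; lra.
have m4a : m ^+ 4 <= (66 * a) ^+ 2.
  have -> : m ^+ 4 = (m ^+ 2) ^+ 2 by rewrite -exprM.
  by rewrite ler_sqr ?nnegrE//; lra.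
have a2 := sqr_ge0 a; rewrite exprMn.
move: m4a; rewrite exprMn; set b := a ^+ 2 in a2 s4a *; lra.
Qed.

End normal_moments.

(** Both moments depend on the law of [Y] alone, so they are computed on the real line, under
    [normal_prob] or a Dirac mass. *)
Lemma gaussian_rv_moments {d} {T : measurableType d} {R : realType}
    {P : probability T R} {Y : T -> R} : gaussian_rv P Y -> exists a : R,
  (\int[P]_w (Y w ^+ 2)%:E = a%:E)%E /\
  (\int[P]_w (Y w ^+ 4)%:E <= ((210 * a) ^+ 2)%:E)%E.
Proof.
move=> [mY [m [s law]]].
have mX k : measurable_fun [set: R] (fun x : R => (x ^+ k)%:E).
  by apply/measurable_EFinP; exact: measurable_funX.
have pos k (x : R) : ~~ odd k -> (0 <= (x ^+ k)%:E)%E.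
  by move=> k2; rewrite lee_fin exprn_even_ge0.
pose Z : {mfun T >-> measurableTypeR R} :=
  HB.pack (Y : T -> measurableTypeR R)
    (@isMeasurableFun.Build _ _ T (measurableTypeR R) Y mY).
have push k : ~~ odd k -> (\int[P]_w (Y w ^+ k)%:E =
    \int[distribution P Z]_x ((x : R) ^+ k)%:E)%E.
  move=> k2; rewrite ge0_integral_distribution //; first exact: mX.
  by move=> x; exact: pos.
rewrite !push//; have [s0|s0] := eqVneq s 0.
  have E k : (\int[distribution P Z]_x ((x : R) ^+ k)%:E = (m ^+ k)%:E)%E.
    rewrite (eq_measure_integral (dirac (m : measurableTypeR R))) => [|A mA _].
      rewrite integral_dirac //; last exact: mX.
      by rewrite diracE in_setT mul1e.
    by rewrite [LHS]law// /gaussian_law s0 eqxx.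
  (* Under a Dirac mass the fourth moment is the square of the second, and [1 <= 210^2]. *)
  exists (m ^+ 2); rewrite !E; split => //.
  by rewrite lee_fin exprMn -exprM ler_peMl ?exprn_even_ge0 // exprn_ege1 //
    ler1n.
have E k : (\int[distribution P Z]_x ((x : R) ^+ k)%:E =
    \int[normal_prob m s]_x ((x : R) ^+ k)%:E)%E.
  apply: eq_measure_integral => A mA _.
  by rewrite [LHS]law// /gaussian_law (negbTE s0).
by rewrite !E; exact: normal_moments.
Qed.

(** * Maximal inequality for fourth powers, and almost sure convergence *)

Section maximal_inequality.
Context {d} {T : measurableType d} {R : realType}.
Variable P : {measure set T -> \bar R}.

(** The window has the [l + 1] indices from [m] to [m + l]. The default 0 of the maximum is harmless
    because fourth powers are nonnegative. The centre [c] will be [S m] for increments and 0 for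
    tails. *)
Definition max_dev4 (S : nat -> T -> R) (c : T -> R) (m l : nat) (w : T) : R :=
  \big[Order.max/0]_(i < l.+1) (S (m + i)%N w - c w) ^+ 4.

Lemma max_dev4_ge0 S c m l w : 0 <= max_dev4 S c m l w.
Proof. exact: bigmax_ge_id. Qed.

Lemma measurable_max_dev4 S c m l : (forall n, measurable_fun [set: T] (S n)) ->
  measurable_fun [set: T] c -> measurable_fun [set: T] (max_dev4 S c m l).
Proof.
move=> mS mc; rewrite /max_dev4; elim: (index_enum _) => [|k s ih].
  by under eq_fun do rewrite big_nil; exact: measurable_cst.
under eq_fun do rewrite big_cons /=.
apply: measurable_maxr => //; apply: measurable_funX.
exact: measurable_funB.
Qed.

Lemma le_max_dev4 S c m l i w : (i <= l)%N ->
  (S (m + i)%N w - c w) ^+ 4 <= max_dev4 S c m l w.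
Proof.
move=> il; have il' : (i < l.+1)%N by [].
exact: (le_bigmax 0 (fun i : 'I_l.+1 => (S (m + i)%N w - c w) ^+ 4)
  (Ordinal il')).
Qed.

Variables (S : nat -> T -> R) (v : nat -> R) (C : R).
Hypothesis mS : forall n, measurable_fun [set: T] (S n).
Hypothesis C0 : 0 <= C.
Hypothesis v_decr : forall m n, (m <= n)%N -> v n <= v m.
Hypothesis S_incr4 : forall m n, (m <= n)%N ->
  (\int[P]_w ((S n w - S m w) ^+ 4)%:E <= (C * (v m - v n) ^+ 2)%:E)%E.

(** An index before the cut [p] lies in the first window; after it, the deviation passes through
    [S (m + p)] and [pow4D_le2] applies. The two bounds are added rather than compared, so that they
    can be integrated. *)
Lemma max_dev4_split m p l w : (0 < p <= l)%N ->
  max_dev4 S (S m) m l w <= max_dev4 S (S m) m p.-1 w +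
   (2 * max_dev4 S (S (m + p)%N) (m + p) (l - p) w
    + 125 * (S (m + p)%N w - S m w) ^+ 4).
Proof.
move=> /andP[p0 pl].
have D1 := max_dev4_ge0 S (S m) m p.-1 w.
have D2 := max_dev4_ge0 S (S (m + p)%N) (m + p) (l - p) w.
have D3 : 0 <= (S (m + p)%N w - S m w) ^+ 4 by rewrite exprn_even_ge0.
apply: bigmax_le => [|i _]; first lra.
have il : (i <= l)%N by rewrite -ltnS.
have [ip|pi] := ltnP i p.
  have ip' : (i <= p.-1)%N by rewrite -ltnS prednK.
  by have := le_max_dev4 S (S m) m _ _ w ip'; lra.
have := @le_max_dev4 S (S (m + p)%N) (m + p) (l - p) (i - p) w (leq_sub2r p il).
rewrite -addnA subnKC//.
have := pow4D_le2 (S (m + i)%N w - S (m + p)%N w) (S (m + p)%N w - S m w).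
by rewrite addrA subrK; lra.
Qed.

Lemma integral_max_dev4_split m p l : (0 < p <= l)%N ->
  (\int[P]_w (max_dev4 S (S m) m l w)%:E <=
   \int[P]_w (max_dev4 S (S m) m p.-1 w)%:E +
   (2%:E * \int[P]_w (max_dev4 S (S (m + p)%N) (m + p) (l - p) w)%:E
    + 125%:E * \int[P]_w ((S (m + p)%N w - S m w) ^+ 4)%:E))%E.
Proof.
move=> pl.
have mD c k j : measurable_fun [set: T] (fun w => (max_dev4 S (S c) k j w)%:E).
  by apply/measurable_EFinP; exact: measurable_max_dev4.
have mp : measurable_fun [set: T] (fun w => ((S (m + p)%N w - S m w) ^+ 4)%:E).
  by apply/measurable_EFinP/measurable_funX/measurable_funB.
have p4 (x : R) : (0 <= (x ^+ 4)%:E)%E by rewrite lee_fin exprn_even_ge0.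
have D0 c k j w : (0 <= (max_dev4 S (S c) k j w)%:E)%E.
  by rewrite lee_fin max_dev4_ge0.
have c2 : (0 <= 2%:E :> \bar R)%E by rewrite lee_fin.
have c125 : (0 <= 125%:E :> \bar R)%E by rewrite lee_fin.
rewrite -!ge0_integralZl//.
have m2 c k j : measurable_fun [set: T]
    (fun w => (2%:E * (max_dev4 S (S c) k j w)%:E)%E).
  exact: emeasurable_funM.
have mp125 : measurable_fun [set: T]
    (fun w => (125%:E * ((S (m + p)%N w - S m w) ^+ 4)%:E)%E).
  exact: emeasurable_funM.
rewrite -[X in (_ + X)%E]ge0_integralD//; last 2 first.
- by move=> w _; rewrite mule_ge0.
- by move=> w _; rewrite mule_ge0.
rewrite -ge0_integralD//; last 2 first.
- by move=> w _; rewrite adde_ge0 ?mule_ge0.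
- exact: emeasurable_funD.
apply: ge0_le_integral => //.
- by apply: emeasurable_funD => //; exact: emeasurable_funD.
- by move=> w _; rewrite -!EFinM -!EFinD lee_fin; exact: max_dev4_split.
Qed.

(* Bisection: cut [m, m + l] where [v] has lost half of its total decrease;
   each half contributes at most a quarter of the bound. *)
Lemma integral_max_dev4_le m l :
  (\int[P]_w (max_dev4 S (S m) m l w)%:E <=
     (500 * C * (v m - v (m + l)%N) ^+ 2)%:E)%E.
Proof.
elim/ltn_ind: l m => l ih m.
have vml : v (m + l)%N <= v m by apply: v_decr; exact: leq_addr.
have [->|l0] := eqVneq l 0%N.
  rewrite addn0 subrr expr0n /= mulr0 integral0_eq// => w _.
  by rewrite /max_dev4 big_ord_recl big_ord0 addn0 subrr expr0n/= maxxx.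
rewrite -lt0n in l0.
set u := v m - v (m + l)%N; have u0 : 0 <= u by rewrite subr_ge0.
(* The cut must be positive, even if [u = 0], for both windows to be strictly shorter than [l]. *)
pose Q i := (0 < i)%N && (u / 2 <= v m - v (m + i)%N).
have exQ : exists i, Q i by exists l; rewrite /Q l0 /= -/u; lra.
case: (ex_minnP exQ) => p /andP[p0 up] minp.
have pl : (p <= l)%N by apply: minp; rewrite /Q l0/= -/u; lra.
(* By minimality of [p], at most half of the decrease occurs before the cut. *)
have up1 : v m - v (m + p.-1)%N <= u / 2.
  have [p1|p1] := posnP p.-1; first by rewrite p1 addn0 subrr; lra.
  rewrite leNgt; apply/negP => up1.
  have := minp p.-1; rewrite /Q p1 (ltW up1) => /(_ isT).
  by rewrite -ltnS prednK// ltnn.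
have v1 : 0 <= v m - v (m + p.-1)%N by rewrite subr_ge0 v_decr// leq_addr.
have v2 : 0 <= v (m + p)%N - v (m + l)%N by rewrite subr_ge0 v_decr// leq_add2l.
have v3 : 0 <= v m - v (m + p)%N by rewrite subr_ge0 v_decr// leq_addr.
have sq (x y : R) : 0 <= x -> x <= y -> C * x ^+ 2 <= C * y ^+ 2.
  by move=> x0 xy; rewrite ler_wpM2l// ler_sqr ?nnegrE// (le_trans x0).
apply: le_trans (integral_max_dev4_split m p l _) _; first by rewrite p0.
have h1 := ih p.-1 _ m; have h2 := ih (l - p)%N _ (m + p)%N.
have h3 := @S_incr4 m (m + p)%N (leq_addr _ _).
have ih1 : (p.-1 < l)%N by rewrite prednK.
have ih2 : (l - p < l)%N by rewrite ltn_subrL p0 l0.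
rewrite -addnA subnKC// in h2.
(* In units of [C * u^2] the three terms are at most [500 / 4], [2 * 500 / 4] and [125], which add
   up to exactly 500. *)
apply: (@le_trans _ _ ((500 * C * (v m - v (m + p.-1)%N) ^+ 2)%:E +
  (2%:E * (500 * C * (v (m + p)%N - v (m + l)%N) ^+ 2)%:E +
   125%:E * (C * (v m - v (m + p)%N) ^+ 2)%:E))%E).
  by rewrite !leeD// ?h1// lee_wpmul2l ?lee_fin// ?h2.
rewrite -!EFinM -!EFinD lee_fin.
have := sq _ (u / 2) v1 up1; have := sq _ (u / 2) v2; have := sq _ u v3.
rewrite !exprMn; rewrite /u in up *.
have -> : v (m + p)%N - v (m + l)%N <= (v m - v (m + l)%N) / 2 by lra.
have -> : v m - v (m + p)%N <= v m - v (m + l)%N by lra.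
by move=> /(_ isT) + /(_ isT); lra.
Qed.

Hypothesis v0 : forall n, 0 <= v n.
Hypothesis S4 : forall n, (\int[P]_w ((S n w) ^+ 4)%:E <= (C * v n ^+ 2)%:E)%E.

Let tail4 (m : nat) (w : T) : \bar R := esups (fun k => ((S k w) ^+ 4)%:E) m.

Let max4_nd m w : nondecreasing_seq (fun l => (max_dev4 S (cst 0) m l w)%:E).
Proof.
move=> a b ab; rewrite lee_fin; apply: bigmax_le; first exact: max_dev4_ge0.
move=> i _; apply: le_max_dev4; apply: leq_trans ab.
by rewrite -ltnS.
Qed.

(** A supremum over infinitely many indices becomes an increasing limit of finite maxima, to which
    monotone convergence applies. *)
Let tail4_cvg m w : (max_dev4 S (cst 0) m l w)%:E @[l --> \oo] --> tail4 m w.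
Proof.
rewrite (_ : tail4 m w =
    ereal_sup (range (fun l => (max_dev4 S (cst 0) m l w)%:E))).
  exact: ereal_nondecreasing_cvgn.
apply/eqP; rewrite eq_le; apply/andP; split; last first.
  apply: ge_ereal_sup => _ [l _ <-].
  have pos (i : 'I_l.+1) : predT i -> 0 <= (S (m + i)%N w - cst 0 w) ^+ 4.
    by rewrite exprn_even_ge0.
  have [i _ maxE] := @eq_bigmax _ _ 'I_l.+1 0 ord0 predT
    (fun i => (S (m + i)%N w - cst 0 w) ^+ 4) isT pos.
  rewrite /max_dev4 maxE.
  apply: ereal_sup_ubound; exists (m + i)%N; first exact: leq_addr.
  by rewrite /= subr0.
apply: ge_ereal_sup => _ [k /= mk <-].
apply: (@le_trans _ _ (max_dev4 S (cst 0) m (k - m) w)%:E); last first.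
  by apply: ereal_sup_ubound; exists (k - m)%N.
rewrite lee_fin; have := le_max_dev4 S (cst 0) m (k - m) (k - m) w (leqnn _).
by rewrite subnKC//= subr0.
Qed.

(** Each [S k] is [(S k - S m) + S m], and [pow4D_le] costs a factor 8: [8 * (500 * C)] comes from
    the maximal inequality, uniformly in [l], and [8 * C] from [S4]. *)
Let integral_tail4_le m :
  (\int[P]_w tail4 m w <= ((8 * (500 * C) + 8 * C) * v m ^+ 2)%:E)%E.
Proof.
have mE l : measurable_fun [set: T] (fun w => (max_dev4 S (cst 0) m l w)%:E).
  apply/measurable_EFinP; apply: measurable_max_dev4 => //.
have E0 l w : (0 <= (max_dev4 S (cst 0) m l w)%:E)%E.
  by rewrite lee_fin max_dev4_ge0.
have -> : (\int[P]_w tail4 m w =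
    limn (fun l => \int[P]_w (max_dev4 S (cst 0) m l w)%:E))%E.
  rewrite -monotone_convergence//.
  by apply: eq_integral => w _; apply/esym/cvg_lim => //; exact: tail4_cvg.
apply: lime_le.
  apply: ereal_nondecreasing_is_cvgn => a b ab.
  by apply: ge0_le_integral => // w _; exact: max4_nd.
apply: nearW => l.
have mD : measurable_fun [set: T] (fun w => (max_dev4 S (S m) m l w)%:E).
  by apply/measurable_EFinP; exact: measurable_max_dev4.
have mS4 : measurable_fun [set: T] (fun w => ((S m w) ^+ 4)%:E).
  by apply/measurable_EFinP/measurable_funX.
have D0 w : (0 <= (max_dev4 S (S m) m l w)%:E)%E.
  by rewrite lee_fin max_dev4_ge0.
have S0 w : (0 <= ((S m w) ^+ 4)%:E)%E by rewrite lee_fin exprn_even_ge0.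
have c8 : (0 <= 8%:E :> \bar R)%E by rewrite lee_fin.
have m8 f : measurable_fun [set: T] f ->
    measurable_fun [set: T] (fun w => 8%:E * f w)%E.
  by move=> mf; exact: emeasurable_funM.
apply: (@le_trans _ _ (\int[P]_w (8%:E * (max_dev4 S (S m) m l w)%:E +
    8%:E * ((S m w) ^+ 4)%:E))%E).
  apply: ge0_le_integral => //.
    by apply: emeasurable_funD; exact: m8.
  move=> w _; rewrite -!EFinM -EFinD lee_fin.
  have D1 := max_dev4_ge0 S (S m) m l w.
  have S1 : 0 <= (S m w) ^+ 4 by rewrite exprn_even_ge0.
  apply: bigmax_le => [|i _]; first lra.
  have il : (i <= l)%N by rewrite -ltnS.
  have := le_max_dev4 S (S m) m l i w il.
  by have := pow4D_le (S (m + i)%N w - S m w) (S m w); rewrite subrK subr0; lra.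
rewrite ge0_integralD//; last 4 first.
- by move=> w _; rewrite mule_ge0.
- exact: m8.
- by move=> w _; rewrite mule_ge0.
- exact: m8.
rewrite !ge0_integralZl//.
apply: (@le_trans _ _ (8%:E * (500 * C * (v m - v (m + l)%N) ^+ 2)%:E +
   8%:E * (C * v m ^+ 2)%:E)%E).
  by rewrite leeD// lee_wpmul2l// integral_max_dev4_le.
rewrite -!EFinM -EFinD lee_fin.
have : C * (v m - v (m + l)%N) ^+ 2 <= C * v m ^+ 2.
  rewrite ler_wpM2l// ler_sqr ?nnegrE// ?subr_ge0 ?v_decr// ?leq_addr//.
  by rewrite gerBl.
lra.
Qed.

(** The upper limit of [S k ^+ 4] lies below every tail supremum, so its integral is at most a
    multiple of [v m ^+ 2] for all [m], hence 0. *)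
Lemma ae_cvg0_of_incr4 : v n @[n --> \oo] --> 0 ->
  {ae P, forall w, S n w @[n --> \oo] --> 0}.
Proof.
move=> v_cvg.
pose L w := limn_esup (fun k => ((S k w) ^+ 4)%:E).
have L_le m w : (L w <= tail4 m w)%E.
  rewrite /L limn_esup_lim; apply: lime_le; first exact: is_cvg_esups.
  by exists m => // k mk; exact: nonincreasing_esups.
have tail_ge0 m w : (0 <= tail4 m w)%E.
  apply: (@le_trans _ _ ((S m w) ^+ 4)%:E).
    by rewrite lee_fin exprn_even_ge0.
  by apply: ereal_sup_ubound; exists m => /=.
have mu4 k : measurable_fun [set: T] (fun w => ((S k w) ^+ 4)%:E).
  by apply/measurable_EFinP/measurable_funX.
have mL : measurable_fun [set: T] L by exact: measurable_fun_limn_esup.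
have mtail m : measurable_fun [set: T] (tail4 m) by exact: measurable_fun_esups.
have L0 w : (0 <= L w)%E.
  rewrite /L limn_esup_lim; apply: lime_ge; first exact: is_cvg_esups.
  by apply: nearW => m; exact: tail_ge0.
have intL : (\int[P]_w L w = 0)%E.
  apply/eqP; rewrite eq_le integral_ge0// andbT.
  have bnd : (fun m => ((8 * (500 * C) + 8 * C) * v m ^+ 2)%:E) @ \oo --> 0%:E.
    apply: cvg_EFin; first exact: nearW.
    rewrite -[X in _ --> X](mulr0 (8 * (500 * C) + 8 * C)).
    apply: cvgMr; rewrite -[X in _ --> X](mulr0 0).
    by under eq_fun do rewrite expr2; exact: cvgM.
  have lim0 := cvg_lim (@ereal_hausdorff R) bnd.
  rewrite -[leRHS]lim0; apply: lime_ge; first by apply/cvg_ex; exists 0%:E.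
  apply: nearW => m; apply: le_trans (integral_tail4_le m).
  by apply: ge0_le_integral.
have : ae_eq P [set: T] L (cst 0%E).
  apply/ae_eq_integral_abs => //.
  by under eq_integral do rewrite gee0_abs//.
apply: filterS => w /(_ I) Lw.
have c4 : ((S k w) ^+ 4)%:E @[k --> \oo] --> 0%E.
  apply: limn_esup_le_cvg; first by rewrite -/(L w) Lw.
  by move=> n; rewrite lee_fin exprn_even_ge0.
have {c4} c4 : (S k w) ^+ 4 @[k --> \oo] --> 0 by exact: (fine_cvg c4).
apply/cvgrPdist_lt => e e0.
have /cvgrPdist_lt/(_ (e ^+ 4)) := c4; rewrite exprn_gt0// => /(_ isT).
apply: filterS => k; rewrite !sub0r !normrN normrX.
by rewrite ltr_pXn2r// nnegrE// ltW.
Qed.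

End maximal_inequality.

(** * Second differences of powers and freeness of the covariance kernel *)

Section powR_kernel.
Context {R : realType}.
Implicit Types (p q x y u h : R).

(** Young's inequality for [x^q] and 1, with the conjugate exponents [1/q] and [1/(1 - q)]. *)
Lemma powR_le_affine q x : 0 < q < 1 -> 0 <= x -> x `^ q <= 1 + q * (x - 1).
Proof.
move=> /andP[q0 q1] x0.
have q'0 : 0 < 1 - q by rewrite subr_gt0.
have := @conjugate_powR R (x `^ q) 1 q^-1 (1 - q)^-1 (powR_ge0 _ _) ler01.
rewrite !invr_gt0 !invrK subrKC => /(_ q0 q'0 erefl).
by rewrite mulr1 -powRrM mulfV ?gt_eqF// powRr1// powR1; lra.
Qed.

(** The preceding bound with exponent [1/p] at the point [x^p]. *)
Lemma powR_ge_affine p x : 1 < p -> 0 <= x -> 1 + p * (x - 1) <= x `^ p.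
Proof.
move=> p1 x0; have p0 : 0 < p by rewrite (lt_trans ltr01).
have := @powR_le_affine p^-1 (x `^ p).
rewrite invr_gt0 p0 invf_lt1// p1 powR_ge0 => /(_ isT isT).
rewrite -powRrM mulfV ?gt_eqF// powRr1// => h.
have := ler_wpM2l (ltW p0) h; rewrite mulrDr mulrA mulfV ?gt_eqF//.
by lra.
Qed.

(** From below, the tangent at 1 is used. From above, [x^p = x * x^(p-1)] with [0 < p - 1 < 1], and
    the affine bound on the second factor leaves [2 (p - 1) u^2]. *)
Lemma powR_second_diff1 p u : 1 < p < 2 -> 0 <= u <= 1 ->
  `|(1 + u) `^ p + (1 - u) `^ p - 2| <= 2 * u ^+ 2.
Proof.
move=> /andP[p1 p2] /andP[u0 u1].
have up x : 0 <= x -> x `^ p <= x * (1 + (p - 1) * (x - 1)).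
  move=> x0; have [->|xn0] := eqVneq x 0.
    by rewrite powR0 ?gt_eqF ?mul0r// (lt_trans ltr01).
  rewrite -[in leLHS](subrKC 1 p) powRD; last by rewrite xn0 implybT.
  rewrite powRr1// ler_wpM2l// powR_le_affine//.
  by rewrite subr_gt0 p1/= ltrBlDr.
have p0 : 0 <= 1 + u by lra.
have m0 : 0 <= 1 - u by lra.
have := up _ p0; have := up _ m0.
have := powR_ge_affine p _ p1 p0; have := powR_ge_affine p _ p1 m0.
have : p * u ^+ 2 <= 2 * u ^+ 2 by rewrite ler_wpM2r ?sqr_ge0// ltW.
rewrite ler_norml !expr2 => *; apply/andP; split; nra.
Qed.

Lemma powR_second_diff p y h : 1 < p < 2 -> 0 < h < y ->
  `|(y + h) `^ p + (y - h) `^ p - 2 * y `^ p| <= 2 * y `^ p / y ^+ 2 * h ^+ 2.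
Proof.
move=> hp /andP[h0 hy]; have y0 : 0 < y by exact: lt_trans hy.
have u01 : 0 <= h / y <= 1.
  by rewrite divr_ge0 ?(ltW h0) ?(ltW y0)//= ler_pdivrMr// mul1r ltW.
have -> : y + h = y * (1 + h / y) by field; rewrite gt_eqF.
have -> : y - h = y * (1 - h / y) by field; rewrite gt_eqF.
have /andP[u0 u1] := u01.
rewrite !powRM ?subr_ge0 ?addr_ge0 ?(ltW y0)//.
rewrite [X in `|_ - X|]mulrC -mulrDr -mulrBr normrM ger0_norm ?powR_ge0//.
rewrite [leRHS](_ : _ = y `^ p * (2 * (h / y) ^+ 2)).
  by rewrite ler_wpM2l ?powR_ge0// powR_second_diff1.
by field; rewrite gt_eqF.
Qed.

(* Near [t j] every summand is twice differentiable, up to the single term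
   [a j * `|t j - s| `^ p] whose second difference is of order [h `^ p]. *)
Lemma fBm_kernel_free n (t a : 'I_n -> R) p : 1 < p < 2 ->
  injective t -> (forall i, 0 < t i) ->
  (forall s, 0 <= s ->
    \sum_i a i * (t i `^ p + s `^ p - `|t i - s| `^ p) = 0) ->
  forall j, a j = 0.
Proof.
move=> hp tinj t0 f0 j; have /andP[p1 p2] := hp.
set x := t j; have x0 : 0 < x by exact: t0.
(* [y i] is the distance from [x] to a singularity: to [t i] if [i != j], while the slot [j] holds
   the distance to 0, the singularity of [s^p]. A step [h < D] reaches none of them. *)
pose y i := if i == j then x else `|t i - x|.
have y0 i : 0 < y i.
  rewrite /y; case: eqVneq => // ij; rewrite normr_gt0 subr_eq0.
  by apply: contra_neq ij => /tinj.
pose D := \big[Order.min/x]_i y i.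
have D0 : 0 < D.
  rewrite /D; apply: (big_ind (fun z => 0 < z)) => // u v u0 v0.
  by rewrite lt_min u0.
have Dy i : D <= y i by exact: bigmin_le.
pose K := (\sum_i `|a i|) * (2 * x `^ p / x ^+ 2) +
  \sum_i `|a i| * (2 * y i `^ p / y i ^+ 2).
have Kx0 : 0 <= 2 * x `^ p / x ^+ 2.
  by apply: divr_ge0; [apply: mulr_ge0; rewrite ?powR_ge0|exact: sqr_ge0].
have Ki0 i : 0 <= 2 * y i `^ p / y i ^+ 2.
  by apply: divr_ge0; [apply: mulr_ge0; rewrite ?powR_ge0|exact: sqr_ge0].
have K0 : 0 <= K.
  apply: addr_ge0; first by apply: mulr_ge0 => //; exact: sumr_ge0.
  by apply: sumr_ge0 => i _; exact: mulr_ge0.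
have key h : 0 < h < D -> 2 * `|a j| * h `^ p <= K * h ^+ 2.
  move=> /andP[h0 hD].
  have hx : h < x by apply: lt_le_trans hD (bigmin_le_id _ _ _ _).
  pose c s := s `^ p; pose g i s := `|t i - s| `^ p.
  pose dd (u : R -> R) := u (x + h) + u (x - h) - 2 * u x.
  have ddc : `|dd c| <= 2 * x `^ p / x ^+ 2 * h ^+ 2.
    by apply: powR_second_diff => //; rewrite h0.
  have ddg i : i != j -> `|dd (g i)| <= 2 * y i `^ p / y i ^+ 2 * h ^+ 2.
    move=> ij; have := Dy i; have := y0 i; rewrite /y (negbTE ij) => yi0 Dyi.
    have hyi : 0 < h < `|t i - x| by rewrite h0 (lt_le_trans hD).
    rewrite /dd /g; apply: le_trans (powR_second_diff _ _ _ hp hyi).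
    move: hyi => /andP[_]; have [z0|z0] := leP 0 (t i - x).
      rewrite (ger0_norm z0) => hz.
      rewrite (@ger0_norm _ (t i - (x + h))); last lra.
      rewrite (@ger0_norm _ (t i - (x - h))); last lra.
      by rewrite opprD opprB addrA addrCA (addrC h) (addrC (_ `^ p)).
    rewrite (ltr0_norm z0) => hz.
    rewrite (@ler0_norm _ (t i - (x + h))); last lra.
    rewrite (@ler0_norm _ (t i - (x - h))); last lra.
    rewrite !opprB (addrC x h) (addrC x (- h)) -!addrA.
    by rewrite (addrC h) (addrC (- h)) !addrA.
  have ddgj : dd (g j) = 2 * h `^ p.
    rewrite /dd /g subrr normr0 powR0 ?gt_eqF ?(lt_trans _ p1)//.
    rewrite opprD addrA subrr sub0r normrN opprB addrCA subrr addr0.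
    by rewrite (gtr0_norm h0) mulr0 subr0; lra.
  (* The hypothesis is used at [x + h], [x - h] and [x], where [h < x] keeps [x - h] nonnegative;
     the constants [t i ^ p] cancel. *)
  have dd0 : \sum_i a i * (dd c - dd (g i)) = 0.
    rewrite (eq_bigr (fun i => a i * (t i `^ p + c (x + h) - g i (x + h)) +
      (a i * (t i `^ p + c (x - h) - g i (x - h)) -
       2 * (a i * (t i `^ p + c x - g i x))))); last first.
      by move=> i _; rewrite /dd; ring.
    rewrite big_split /= sumrB -mulr_sumr !f0 ?mulr0 ?subrr ?addr0//; lra.
  have : (2 * a j) * h `^ p = (\sum_i a i) * dd c -
      \sum_(i | i != j) a i * dd (g i).
    move: dd0; under eq_bigr do rewrite mulrBr.
    by rewrite sumrB -mulr_suml [in X in _ - X](bigD1 j) //= ddgj; lra.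
  move/(congr1 Num.norm); rewrite !normrM (ger0_norm (powR_ge0 _ _)).
  rewrite (@ger0_norm _ 2)// => ->; rewrite /K mulrDl.
  apply: le_trans (ler_normB _ _) _; apply: lerD.
    rewrite normrM -mulrA; apply: ler_pM => //; exact: ler_norm_sum.
  apply: le_trans (ler_norm_sum _ _ _) _.
  rewrite mulr_suml [leRHS](bigID (fun i => i != j)) /=.
  rewrite -[leLHS]addr0; apply: lerD; last first.
    apply: sumr_ge0 => i _; apply: mulr_ge0; last exact: sqr_ge0.
    exact: mulr_ge0.
  by apply: ler_sum => i ij; rewrite normrM -mulrA ler_wpM2l// ddg.
apply/eqP/negPn/negP => aj0; rewrite -normr_gt0 in aj0.
have q0 : 0 < 2 - p by rewrite subr_gt0.
(* With [h^(2-p) <= r], [K h^2 <= K r h^p], and [K r < |a j|] contradicts [key]. Adding 1 to [K]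
   keeps the denominator positive. *)
pose r := `|a j| / (K + 1).
have r0 : 0 < r by rewrite divr_gt0// ltr_wpDl.
pose h := Num.min (D / 2) (r `^ (2 - p)^-1).
have h0 : 0 < h by rewrite lt_min divr_gt0//= powR_gt0.
have hD : h < D by rewrite gt_min ltr_pdivrMr// ltr_pMr// ltr1n.
have hr : h `^ (2 - p) <= r.
  have : h <= r `^ (2 - p)^-1 by rewrite ge_min lexx orbT.
  move/(@ge0_ler_powR _ (2 - p) (ltW q0)); rewrite !nnegrE (ltW h0) powR_ge0.
  by rewrite -powRrM mulVf ?gt_eqF// powRr1 ?(ltW r0)// => /(_ isT isT).
have := key h; rewrite h0 hD => /(_ isT); apply/negP; rewrite -ltNge.
have -> : h ^+ 2 = h `^ (2 - p) * h `^ p.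
  rewrite -powRD; last by rewrite (gt_eqF h0) implybT.
  by rewrite subrK powR_mulrn// ltW.
rewrite mulrA ltr_pM2r ?powR_gt0//.
apply: (@le_lt_trans _ _ (K * r)); first by rewrite ler_wpM2l.
have -> : K * r = `|a j| - r by rewrite /r; field; rewrite gt_eqF// ltr_wpDl.
lra.
Qed.

End powR_kernel.

Lemma powRN_cvg0 {R : realType} (t : nat -> R) (q : R) :
  (forall k, 0 < t k) -> 0 < q -> t k @[k --> \oo] --> +oo ->
  t k `^ (- q) @[k --> \oo] --> 0.
Proof.
move=> t_gt0 q0 t_cvg; apply/cvgrPdist_lt => e e0.
have r0 : 0 < e `^ (- q^-1) by exact: powR_gt0.
have /cvgryPgt/(_ (e `^ (- q^-1))) := t_cvg.
apply: filterS => k tk; rewrite sub0r normrN ger0_norm ?powR_ge0//.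
have -> : e = (e `^ (- q^-1)) `^ (- q).
  by rewrite -powRrM mulrNN mulVf ?gt_eqF// powRr1// ltW.
rewrite (powRN (t k)) (powRN (e `^ _)) ltf_pV2 ?posrE ?powR_gt0//.
by apply: gt0_ltr_powR; rewrite ?nnegrE ?powR_ge0 ?(ltW (t_gt0 _)).
Qed.

(** * Independence, and second moments as a scalar product *)

Section second_moments.
Context {d} {T : measurableType d} {R : realType} (P : probability T R).
Implicit Types X Y Z : T -> R.

(** Independence identifies the joint law with the product of the laws on rectangles, hence
    everywhere; Fubini's theorem then factors the integral. *)
Lemma expectationM_indep (X Y : {RV P >-> R}) :
  (X : T -> R) \in Lfun P 1 -> (Y : T -> R) \in Lfun P 1 ->
  (X \* Y : T -> R) \in Lfun P 1 ->
  (forall A B : set R, measurable A -> measurable B ->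
     P (X @^-1` A `&` Y @^-1` B) = (P (X @^-1` A) * P (Y @^-1` B))%E) ->
  ('E_P[X \* Y] = 'E_P[X] * 'E_P[Y])%E.
Proof.
move=> /Lfun1_integrable iX /Lfun1_integrable iY /Lfun1_integrable iXY indep.
have mXY : measurable_fun [set: T] (fun w => (X w, Y w)).
  exact: measurable_fun_pair.
pose Z : {mfun T >-> (R * R)%type} :=
  HB.pack (fun w => (X w, Y w)) (isMeasurableFun.Build _ _ _ _ _ mXY).
pose f (z : R * R) : \bar R := (z.1 * z.2)%:E.
have mf : measurable_fun [set: R * R] f.
  by apply/measurable_EFinP/measurable_funM.
have prodE (A : set (R * R)) : measurable A ->
    (distribution P X \x distribution P Y)%E A = distribution P Z A.
  by apply: product_measure_unique => B C mB mC; rewrite -[RHS]indep.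
have intE (g : R * R -> \bar R) :
    (\int[(distribution P X \x distribution P Y)%E]_z g z =
     \int[distribution P Z]_z g z)%E.
  by apply: eq_measure_integral => A mA _; exact: prodE.
have intf : (distribution P X \x distribution P Y)%E.-integrable [set: R * R] f.
  apply/integrableP; split => //.
  rewrite intE ge0_integral_distribution//; last exact: measurableT_comp.
  by have /integrableP[_] := iXY.
rewrite expectation.unlock.
transitivity (\int[distribution P Z]_z f z)%E.
  by rewrite integral_distribution.
rewrite -intE -integral12_prod_meas1//=.
have mE : measurable_fun [set: R] (@EFin R).
  by apply/measurable_EFinP; exact: measurable_id.
have idX : (distribution P X).-integrable [set: R] EFin.
  apply/integrableP; split => //.
  rewrite ge0_integral_distribution//; last exact: measurableT_comp.
  by have /integrableP[_] := iX.
have idY : (distribution P Y).-integrable [set: R] EFin.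
  apply/integrableP; split => //.
  rewrite ge0_integral_distribution//; last exact: measurableT_comp.
  by have /integrableP[_] := iY.
have EY : (\int[distribution P Y]_y y%:E = \int[P]_w (Y w)%:E)%E.
  by rewrite integral_distribution.
have EX : (\int[distribution P X]_x x%:E = \int[P]_w (X w)%:E)%E.
  by rewrite integral_distribution.
have fY : (\int[P]_w (Y w)%:E)%E \is a fin_num by exact: integrable_fin_num.
transitivity (\int[distribution P X]_x (x%:E * \int[P]_w (Y w)%:E))%E.
  apply: eq_integral => x _.
  by rewrite /fubini_F /f/= -EY -integralZl//; apply: eq_integral.
by rewrite -(fineK fY) integralZr//= EX.
Qed.

Lemma Lfun2P X : measurable_fun [set: T] X ->
  (\int[P]_w (X w ^+ 2)%:E < +oo)%E -> X \in Lfun P 2%:E.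
Proof.
move=> mX h; rewrite inE; apply/andP; split; rewrite inE//=.
rewrite /finite_norm unlock /Lnorm poweR_lty//.
under eq_integral => w _ do
  rewrite /= powR_mulrn ?normr_ge0 // real_normK ?num_real //.
by [].
Qed.

Lemma Lfun2_lincomb n (a : 'I_n -> R) (X : 'I_n -> T -> R) :
  (forall i, X i \in Lfun P 2%:E) ->
  (fun w => \sum_i a i * X i w) \in Lfun P 2%:E.
Proof.
move=> L2X; have -> : (fun w => \sum_i a i * X i w) = \sum_i (a i \o* X i).
  by apply/funext => w; rewrite fct_sumE; apply: eq_bigr => i _; rewrite mulrC.
apply: rpred_sum => [|p1 i _]; first exact: lee1n.
by apply: Lfun_scale => //; rewrite ler1n.
Qed.

(** For square-integrable arguments [fine] loses nothing, the expectation being finite. *)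
Definition sp X Y : R := fine 'E_P[X \* Y].

Lemma sp_EFin X Y : X \in Lfun P 2%:E -> Y \in Lfun P 2%:E ->
  ('E_P[X \* Y] = (sp X Y)%:E)%E.
Proof.
by move=> ? ?; rewrite /sp fineK// expectation_fin_num// Lfun2_mul_Lfun1.
Qed.

Lemma spC X Y : sp X Y = sp Y X.
Proof.
by rewrite /sp; congr (fine 'E_P[_]); apply/funext => w /=; rewrite mulrC.
Qed.

Lemma sp_ge0 X : 0 <= sp X X.
Proof.
by rewrite fine_ge0// expectation_ge0// => w /=; rewrite -expr2 sqr_ge0.
Qed.

Lemma sp_lincombl n (a : 'I_n -> R) (X : 'I_n -> T -> R) Y :
  (forall i, X i \in Lfun P 2%:E) -> Y \in Lfun P 2%:E ->
  sp (fun w => \sum_i a i * X i w) Y = \sum_i a i * sp (X i) Y.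
Proof.
move=> L2X L2Y; rewrite /sp expectation.unlock.
have iXY i : P.-integrable [set: T] (fun w => (X i w * Y w)%:E).
  by apply/Lfun1_integrable; exact: Lfun2_mul_Lfun1.
transitivity (fine (\int[P]_w \sum_i ((a i)%:E * (X i w * Y w)%:E))%E).
  congr fine; apply: eq_integral => w _ /=.
  rewrite mulr_suml sumEFin; congr EFin.
  by apply: eq_bigr => i _; rewrite mulrA.
rewrite integral_sum//; last by move=> i; exact: integrableZl.
rewrite -sum_fine; last first.
  by move=> i _; rewrite integrable_fin_num//; exact: integrableZl.
apply: eq_bigr => i _; rewrite integralZl// fineM//.
by rewrite integrable_fin_num.
Qed.

Lemma sp_lincombr n (a : 'I_n -> R) (X : 'I_n -> T -> R) Y :
  (forall i, X i \in Lfun P 2%:E) -> Y \in Lfun P 2%:E ->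
  sp Y (fun w => \sum_i a i * X i w) = \sum_i a i * sp Y (X i).
Proof.
move=> L2X L2Y; rewrite spC sp_lincombl//.
by apply: eq_bigr => i _; rewrite spC.
Qed.

Lemma spDl a b X Y Z : X \in Lfun P 2%:E -> Y \in Lfun P 2%:E ->
  Z \in Lfun P 2%:E ->
  sp (fun w => a * X w + b * Y w) Z = a * sp X Z + b * sp Y Z.
Proof.
move=> L2X L2Y L2Z.
have := @sp_lincombl 2 (fun i => if i == ord0 then a else b)
  (fun i => if i == ord0 then X else Y) Z.
rewrite big_ord_recl big_ord1 /= => <- //; last by move=> i; case: ifP.
by congr sp; apply/funext => w; rewrite big_ord_recl big_ord1.
Qed.

Lemma Lfun2D a b X Y : X \in Lfun P 2%:E -> Y \in Lfun P 2%:E ->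
  (fun w => a * X w + b * Y w) \in Lfun P 2%:E.
Proof.
move=> L2X L2Y.
have := @Lfun2_lincomb 2 (fun i => if i == ord0 then a else b)
  (fun i => if i == ord0 then X else Y).
under eq_fun do rewrite big_ord_recl big_ord1 /=.
by apply => i; case: ifP.
Qed.

Lemma sp_sqrD a b X Y : X \in Lfun P 2%:E -> Y \in Lfun P 2%:E ->
  sp (fun w => a * X w + b * Y w) (fun w => a * X w + b * Y w) =
  a ^+ 2 * sp X X + 2 * a * b * sp X Y + b ^+ 2 * sp Y Y.
Proof.
move=> L2X L2Y; have L2W := Lfun2D a b X Y L2X L2Y.
rewrite (spDl a b X Y _ L2X L2Y L2W) (spC X) (spC Y).
rewrite (spDl a b X Y X)// (spDl a b X Y Y)// (spC Y X); ring.
Qed.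

(** Degenerate Cauchy-Schwarz: the second moment of [s X + Y] is affine in [s], and it stays
    nonnegative only if its slope is 0. *)
Lemma sp_eq0 X Y : X \in Lfun P 2%:E -> Y \in Lfun P 2%:E ->
  sp X X = 0 -> sp X Y = 0.
Proof.
move=> L2X L2Y X0.
have h s : 0 <= 2 * s * sp X Y + sp Y Y.
  by have := sp_ge0 (fun w => s * X w + 1 * Y w); rewrite sp_sqrD// X0; lra.
(* At this [s] the affine function equals -1. *)
apply/eqP/negPn/negP => c0; have := h (- (sp Y Y + 1) / (2 * sp X Y)).
rewrite (_ : _ + _ = -1) ?ler0N1//.
by field.
Qed.

End second_moments.

(** * Increments and summation by parts *)

Section increments_algebra.
Context {R : realType}.
Implicit Types (t : nat -> R) (f : R -> R) (x : nat -> R).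

Lemma incrementD t f g i :
  increment t (fun s => f s + g s) i = increment t f i + increment t g i.
Proof. by case: i => //= i; ring. Qed.

Lemma incrementZ t k f i :
  increment t (fun s => k * f s) i = k * increment t f i.
Proof. by case: i => //= i; ring. Qed.

Lemma sum_increment t f n : \sum_(i < n.+1) increment t f i = f (t n).
Proof.
elim: n => [|n ih]; first by rewrite big_ord_recl big_ord0 addr0.
by rewrite big_ord_recr /= ih subrKC.
Qed.

(** Coefficients of the values [f (t k)] after summation by parts; the coefficient following the
    last one counts as 0. *)
Definition abel_coef n x (k : nat) : R :=
  x k - (if (k.+1 < n)%N then x k.+1 else 0).

Lemma sum_increment_abel t f n x :
  \sum_(i < n) x i * increment t f i = \sum_(i < n) abel_coef n x i * f (t i).
Proof.
case: n => [|n]; first by rewrite !big_ord0.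
pose prev i := if i is j.+1 then f (t j) else 0.
have E i : x i * increment t f i = x i * f (t i) - x i * prev i.
  by case: i => [|i] /=; ring.
under eq_bigr do rewrite E.
rewrite sumrB [X in _ - X]big_ord_recl /= mulr0 add0r !big_ord_recr /=.
rewrite /abel_coef ltnn subr0 addrAC -sumrB; congr (_ + _).
by apply: eq_bigr => i _; rewrite ltnS ltn_ord mulrBl.
Qed.

Lemma increment_step t (j i : nat) : {mono t : m n / (m <= n)%N >-> m <= n} ->
  increment t (fun s => (t j <= s)%R%:R) i = (i == j)%:R.
Proof.
move=> tm; case: i => [|i] /=; rewrite !tm ?leqn0 1?eq_sym//.
by rewrite leq_eqVlt ltnS; case: eqVneq => [->|_]; rewrite ?ltnn ?subr0 ?subrr.
Qed.

(** Applied to the step function jumping at [t j], whose increments vanish except the [j]-th,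
    summation by parts returns [x j]. *)
Lemma abel_coef_inj t n x : {mono t : m n / (m <= n)%N >-> m <= n} ->
  (forall i, (i < n)%N -> abel_coef n x i = 0) ->
  forall i, (i < n)%N -> x i = 0.
Proof.
move=> tm a0 j jn.
have := sum_increment_abel t (fun s => (t j <= s)%R%:R) n x.
rewrite [RHS]big1; last by move=> i _; rewrite a0 ?mul0r.
rewrite (bigD1 (Ordinal jn))//= increment_step// eqxx mulr1 big1 ?addr0//.
by move=> i ij; rewrite increment_step// (negbTE (_ : (i : nat) != j)) ?mulr0.
Qed.

End increments_algebra.

(** * Linear combinations of values of one fractional Brownian motion *)

Section fBm_combinations.
Context {d} {T : measurableType d} {R : realType} (P : probability T R).
Context (H : R) (B : R -> {RV P >-> R}).
Hypothesis fBmB : fBm P H B.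

Lemma fBm_comb_moments n (s a : 'I_n -> R) : (forall i, 0 <= s i) ->
  (fun w => \sum_i a i * B (s i) w) \in Lfun P 2%:E /\
  (\int[P]_w ((\sum_i a i * B (s i) w) ^+ 4)%:E <=
    ((210 * sp P (fun w => \sum_i a i * B (s i) w)
                 (fun w => \sum_i a i * B (s i) w)) ^+ 2)%:E)%E.
Proof.
move=> s0; have [+ _ _ _] := fBmB => /(_ n s a s0) g.
have [v [v2 v4]] := gaussian_rv_moments g.
have [mL _] := g; split.
  by apply: Lfun2P => //; rewrite v2 ltry.
apply: (le_trans v4); rewrite /sp expectation.unlock.
rewrite (_ : (\int[P]_w _)%E = v%:E)//.
Qed.

Lemma fBm_L2 s : 0 <= s -> (B s : T -> R) \in Lfun P 2%:E.
Proof.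
move=> s0; have [L _] := @fBm_comb_moments 1 (fun=> s) (fun=> 1) (fun=> s0).
rewrite (_ : (B s : T -> R) = fun w => \sum_(i < 1) 1 * B s w)//.
by apply/funext => w; rewrite big_ord_recl big_ord0 mul1r addr0.
Qed.

Lemma fBm_sp s u : 0 <= s -> 0 <= u -> sp P (B s) (B u) =
  2^-1 * (s `^ (2 * H) + u `^ (2 * H) - `|s - u| `^ (2 * H)).
Proof.
by move=> s0 u0; have [_ _ _ /(_ s u s0 u0) cov] := fBmB; rewrite /sp cov.
Qed.

Lemma fBm_expectation s : 0 <= s -> ('E_P[B s] = 0)%E.
Proof. by move=> s0; have [_ + _ _] := fBmB; exact. Qed.

Lemma fBm_free n (s a : 'I_n -> R) : 2^-1 < H < 1 ->
  injective s -> (forall i, 0 < s i) ->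
  sp P (fun w => \sum_i a i * B (s i) w)
       (fun w => \sum_i a i * B (s i) w) = 0 ->
  forall i, a i = 0.
Proof.
move=> /andP[H0 H1] sinj s0 L0.
have LB i : (B (s i) : T -> R) \in Lfun P 2%:E by rewrite fBm_L2// ltW.
have LL : (fun w => \sum_i a i * B (s i) w) \in Lfun P 2%:E.
  exact: Lfun2_lincomb.
apply: (@fBm_kernel_free R n s a (2 * H)) => //.
  by apply/andP; split; lra.
move=> u u0; have LBu := fBm_L2 u u0.
have := sp_eq0 _ _ _ LL LBu L0; rewrite sp_lincombl//.
under eq_bigr do rewrite fBm_sp ?(ltW (s0 _))// mulrCA.
by rewrite -mulr_sumr => /eqP; rewrite mulf_eq0 invr_eq0 pnatr_eq0/= => /eqP.
Qed.

End fBm_combinations.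

Lemma indep_processes_sp {d} {T : measurableType d} {R : realType}
    (P : probability T R) (B1 B2 : R -> {RV P >-> R}) s u :
  independent_processes P B1 B2 -> 0 <= s -> 0 <= u ->
  (B1 s : T -> R) \in Lfun P 2%:E -> (B2 u : T -> R) \in Lfun P 2%:E ->
  ('E_P[B1 s] = 0)%E -> sp P (B1 s) (B2 u) = 0.
Proof.
move=> ind s0 u0 L1 L2 E0; rewrite /sp expectationM_indep ?E0 ?mul0e//.
- by apply: Lfun_subset12 => //; rewrite fin_num_measure.
- by apply: Lfun_subset12 => //; rewrite fin_num_measure.
- exact: Lfun2_mul_Lfun1.
move=> A C mA mC; apply: ind; apply: sub_sigma_algebra.
- by exists s => //; exists A => //; rewrite setTI.
- by exists u => //; exists C => //; rewrite setTI.
Qed.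

(** * Linear combinations of increments of the sum process *)

Section drift_estimation.
Context {d} {T : measurableType d} {R : realType} (P : probability T R).
Context (H1 H2 : R) (B1 B2 : R -> {RV P >-> R}) (t : nat -> R).
Hypothesis H1_range : 2^-1 < H1 < 1.
Hypothesis H2_range : 2^-1 < H2 < 1.
Hypothesis fBm1 : fBm P H1 B1.
Hypothesis fBm2 : fBm P H2 B2.
Hypothesis indepB : independent_processes P B1 B2.
Hypothesis t_gt0 : forall k, 0 < t k.
Hypothesis t_lt : forall k, t k < t k.+1.

Let B (s : R) (w : T) : R := B1 s w + B2 s w.
Let D (i : nat) (w : T) : R := increment t (B^~ w) i.
Let G (i : nat) : R := increment t id i.

Let comb (n : nat) (x : nat -> R) (w : T) : R := \sum_(i < n) x i * D i w.

Let comb1 n x (w : T) : R := \sum_(i < n) abel_coef n x i * B1 (t i) w.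
Let comb2 n x (w : T) : R := \sum_(i < n) abel_coef n x i * B2 (t i) w.

Let combE n x : comb n x = fun w => 1 * comb1 n x w + 1 * comb2 n x w.
Proof.
apply/funext => w; rewrite !mul1r /comb1 /comb2.
rewrite -(sum_increment_abel t (B1^~ w)) -(sum_increment_abel t (B2^~ w)).
rewrite -big_split.
by apply: eq_bigr => i _; rewrite /D /B /= incrementD mulrDr.
Qed.

Let t_ge0 k : 0 <= t k.
Proof. exact: ltW. Qed.

Let B1_L2 k : (B1 (t k) : T -> R) \in Lfun P 2%:E.
Proof. exact: (fBm_L2 P H1). Qed.

Let B2_L2 k : (B2 (t k) : T -> R) \in Lfun P 2%:E.
Proof. exact: (fBm_L2 P H2). Qed.

Let comb1_L2 n x : comb1 n x \in Lfun P 2%:E.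
Proof. exact: Lfun2_lincomb. Qed.

Let comb2_L2 n x : comb2 n x \in Lfun P 2%:E.
Proof. exact: Lfun2_lincomb. Qed.

Let comb_L2 n x : comb n x \in Lfun P 2%:E.
Proof. by rewrite combE; exact: Lfun2D. Qed.

Let sp12 k l : sp P (B1 (t k)) (B2 (t l)) = 0.
Proof. by apply: indep_processes_sp => //; exact: (fBm_expectation P H1). Qed.

Let sp_comb12 n x : sp P (comb1 n x) (comb2 n x) = 0.
Proof.
rewrite sp_lincombl// big1// => i _; rewrite sp_lincombr// big1 ?mulr0// => j _.
by rewrite sp12 mulr0.
Qed.

Let sp_comb_split n x : sp P (comb n x) (comb n x) =
  sp P (comb1 n x) (comb1 n x) + sp P (comb2 n x) (comb2 n x).
Proof. by rewrite combE sp_sqrD// sp_comb12; ring. Qed.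

Let tm : {mono t : m n / (m <= n)%N >-> m <= n}.
Proof. exact/increasing_seqP. Qed.

Let tinj : injective t.
Proof. exact: inc_inj. Qed.

(** The second moments of the two parts are nonnegative and add up to 0, so the [B1] part is null
    and its Abel coefficients vanish. *)
Let comb_free n x : sp P (comb n x) (comb n x) = 0 ->
  forall i, (i < n)%N -> x i = 0.
Proof.
rewrite sp_comb_split => L0.
have L10 : sp P (comb1 n x) (comb1 n x) = 0.
  apply/eqP; rewrite eq_le sp_ge0 andbT -L0 lerDl; exact: sp_ge0.
apply: (abel_coef_inj t) => // i ilt.
apply: (fBm_free P H1 B1 fBm1 n (fun i => t i) (fun i => abel_coef n x i)
  H1_range _ _ L10 (Ordinal ilt)) => //.
by move=> a b /tinj/val_inj.
Qed.

(** The 8 comes from [pow4D_le] and [210^2] from each Gaussian part; the sum of the squared second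
    moments is at most the square of their sum. *)
Let comb_pow4 n x : (\int[P]_w ((comb n x w) ^+ 4)%:E <=
  (8 * 210 ^+ 2 * (sp P (comb n x) (comb n x)) ^+ 2)%:E)%E.
Proof.
have [_ h1] := fBm_comb_moments P H1 B1 fBm1 n (fun i => t i)
  (fun i => abel_coef n x i) (fun=> t_ge0 _).
have [_ h2] := fBm_comb_moments P H2 B2 fBm2 n (fun i => t i)
  (fun i => abel_coef n x i) (fun=> t_ge0 _).
have m1 : measurable_fun [set: T] (comb1 n x).
  by have := comb1_L2 n x; rewrite inE => /andP[]; rewrite inE.
have m2 : measurable_fun [set: T] (comb2 n x).
  by have := comb2_L2 n x; rewrite inE => /andP[]; rewrite inE.
have m14 : measurable_fun [set: T] (fun w => ((comb1 n x w) ^+ 4)%:E).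
  by apply/measurable_EFinP/measurable_funX.
have m24 : measurable_fun [set: T] (fun w => ((comb2 n x w) ^+ 4)%:E).
  by apply/measurable_EFinP/measurable_funX.
have c8 : (0 <= 8%:E :> \bar R)%E by rewrite lee_fin.
have p4 (x0 : R) : (0 <= (x0 ^+ 4)%:E)%E by rewrite lee_fin exprn_even_ge0.
apply: (@le_trans _ _ (\int[P]_w (8%:E * ((comb1 n x w) ^+ 4)%:E +
  8%:E * ((comb2 n x w) ^+ 4)%:E))%E).
  apply: ge0_le_integral => //.
  - apply/measurable_EFinP/measurable_funX; rewrite combE.
    by apply: measurable_funD; exact: measurable_funM.
  - by apply: emeasurable_funD; exact: emeasurable_funM.
  - move=> w _; rewrite -!EFinM -EFinD lee_fin combE !mul1r; exact: pow4D_le.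
rewrite ge0_integralD//; last 4 first.
- by move=> w _; rewrite mule_ge0.
- exact: emeasurable_funM.
- by move=> w _; rewrite mule_ge0.
- exact: emeasurable_funM.
rewrite !ge0_integralZl//.
apply: le_trans (leeD (lee_wpmul2l c8 h1) (lee_wpmul2l c8 h2)) _.
rewrite -!EFinM -EFinD lee_fin sp_comb_split -/(comb1 n x) -/(comb2 n x).
set a := sp _ _ _; set b := sp _ _ _.
have a0 : 0 <= a by exact: sp_ge0.
have b0 : 0 <= b by exact: sp_ge0.
rewrite !exprMn -mulrDr -mulrDr -mulrA; do 2 rewrite ler_wpM2l//.
by rewrite sqrrD; have := mulr_ge0 a0 b0; lra.
Qed.

Let D_comb i : D i = comb i.+1 (fun k => (k == i)%:R).
Proof.
apply/funext => w; rewrite /comb big_ord_recr /= eqxx mul1r.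
rewrite big1 ?add0r// => k _.
by rewrite ltn_eqF ?mul0r.
Qed.

Let D_L2 i : D i \in Lfun P 2%:E.
Proof. by rewrite D_comb. Qed.

Let sp_combl n x Y : Y \in Lfun P 2%:E ->
  sp P (comb n x) Y = \sum_(i < n) x i * sp P (D i) Y.
Proof. by move=> LY; rewrite sp_lincombl. Qed.

Let sp_combr n x Y : Y \in Lfun P 2%:E ->
  sp P Y (comb n x) = \sum_(i < n) x i * sp P Y (D i).
Proof. by move=> LY; rewrite sp_lincombr. Qed.

Let fin1 : P [set: T] \is a fin_num.
Proof. by rewrite fin_num_measure. Qed.

Let L21 X : X \in Lfun P 2%:E -> X \in Lfun P 1.
Proof. exact: Lfun_subset12. Qed.

Let EB k : ('E_P[fun w => B (t k) w] = 0)%E.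
Proof.
rewrite (expectationD (L21 _ (B1_L2 k)) (L21 _ (B2_L2 k))).
by rewrite (fBm_expectation P H1)// (fBm_expectation P H2)// adde0.
Qed.

Let B_L2 k : (fun w => B (t k) w) \in Lfun P 2%:E.
Proof.
have := Lfun2D P 1 1 _ _ (B1_L2 k) (B2_L2 k).
by under eq_fun do rewrite !mul1r.
Qed.

Let ED i : ('E_P[D i] = 0)%E.
Proof.
case: i => [|i]; first exact: EB.
rewrite (expectationB (L21 _ (B_L2 i.+1)) (L21 _ (B_L2 i))).
by rewrite !EB sube0.
Qed.

Let covE i j : fine (covariance P (D i) (D j)) = sp P (D i) (D j).
Proof.
rewrite covarianceE ?ED ?mul0e ?sube0//; try exact: L21.
exact: Lfun2_mul_Lfun1.
Qed.

(** * The covariance matrix and the weights of the estimator *)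

Let Gamma N := increments_cov P t N B.
Let GammaE N (i j : 'I_N) : Gamma N i j = sp P (D i) (D j).
Proof. by rewrite mxE -covE. Qed.

(** Weights for different sample sizes will be subtracted, so a row vector is prolonged by 0 to a
    sequence. *)
Let ext N (v : 'rV[R]_N) (k : nat) : R := oapp (v 0) 0 (insub k).
Let ext_ord N (v : 'rV[R]_N) (i : 'I_N) : ext N v i = v 0 i.
Proof. by rewrite /ext valK. Qed.
Let ext_out N (v : 'rV[R]_N) k : (N <= k)%N -> ext N v k = 0.
Proof. by move=> Nk; rewrite /ext insubF// ltnNge Nk. Qed.

Let sp_ext N (v : 'rV[R]_N) (j : 'I_N) :
  sp P (comb N (ext N v)) (D j) = (v *m Gamma N) 0 j.
Proof.
rewrite sp_combl// mxE; apply: eq_bigr => i _.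
by rewrite ext_ord GammaE.
Qed.

Let sp_ext2 N (v : 'rV[R]_N) :
  sp P (comb N (ext N v)) (comb N (ext N v)) = (v *m Gamma N *m v^T) 0 0.
Proof.
rewrite sp_combr// mxE; apply: eq_bigr => i _.
by rewrite ext_ord sp_ext [v^T i 0]mxE mulrC.
Qed.

(** A kernel vector is the weight vector of a combination of null variance. *)
Let Gamma_unit N : Gamma N \in unitmx.
Proof.
rewrite -row_free_unit -kermx_eq0; apply/rowV0P => v /sub_kermxP vG.
apply/rowP => i; rewrite mxE -ext_ord.
apply: (comb_free N) => //.
by rewrite sp_ext2 vG mul0mx mxE.
Qed.

Let Gcol N := increments t N id.

(** Gauss-Markov weights: [r = G^T Gamma^-1] divided by [g = r G]. Pairing them with [Gamma] gives
    [G / g], so the variance is [1 / g]. The sample size is [N.+1] since [g] is 0 for an empty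
    sample. *)
Let blue_exists (theta : R) N : exists c : nat -> R,
  [/\ forall w, mle P t N.+1 B (fun s w => theta * s + B1 s w + B2 s w) w =
        theta + comb N.+1 c w,
      forall i, (N < i)%N -> c i = 0,
      \sum_(i < N.+1) c i * G i = 1 &
      forall j, (j <= N)%N -> sp P (comb N.+1 c) (D j) =
        sp P (comb N.+1 c) (comb N.+1 c) * G j].
Proof.
set n := N.+1; pose r : 'rV[R]_n := (Gcol n)^T *m invmx (Gamma n).
have rG : r *m Gamma n = (Gcol n)^T by rewrite mulmxKV.
pose g := (r *m Gcol n) 0 0.
have gE : g = sp P (comb n (ext n r)) (comb n (ext n r)).
  by rewrite sp_ext2 rG -trmx_mul [RHS]mxE.
(* If [g = 0], then [r = 0] and so [G = 0], whereas the first entry of [G] is [t 0 > 0]. *)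
have g0 : g != 0.
  rewrite gE; apply/eqP => /comb_free r0.
  have : (Gcol n)^T 0 ord0 = 0.
    rewrite -rG mxE big1// => i _.
    by rewrite -ext_ord r0// mul0r.
  by rewrite !mxE /= => /eqP; rewrite gt_eqF.
exists (ext n (g^-1 *: r)); set c := ext n _.
have cE (i : 'I_n) : c i = g^-1 * r 0 i by rewrite /c ext_ord mxE.
have cG : \sum_(i < n) c i * G i = 1.
  transitivity (g^-1 * g); last by rewrite mulVf.
  rewrite {2}/g mxE mulr_sumr; apply: eq_bigr => i _.
  by rewrite cE [Gcol n i 0]mxE mulrA.
have cD j : (j <= N)%N -> sp P (comb n c) (D j) = g^-1 * G j.
  move=> jN; have jn : (j < n)%N by [].
  have -> : D j = D (Ordinal jn) by [].
  by rewrite sp_ext -scalemxAl rG 3!mxE.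
split => // [w|i Ni|j jN].
- rewrite /mle -/(Gamma n) -/(Gcol n) -/r -/g.
  have -> : increments t n ((fun s w => theta * s + B1 s w + B2 s w)^~ w) =
     theta *: Gcol n + \col_(i < n) D i w.
    apply/colP => i; rewrite !mxE -incrementZ -incrementD.
    by congr increment; apply/funext => s /=; rewrite addrA.
  rewrite mulmxDr -scalemxAr mxE [X in (X + _) / _]mxE -/g mulrDl mulfK//.
  congr (_ + _); rewrite mxE mulr_suml; apply: eq_bigr => i _.
  by rewrite [(\col__ _) i 0]mxE cE; ring.
- exact: ext_out.
- rewrite cD// sp_combr//; congr (_ * _).
  transitivity (\sum_(i < n) g^-1 * (c i * G i)).
    by rewrite -mulr_sumr cG mulr1.
  by apply: eq_bigr => i _; rewrite cD ?(leq_ord i)//; ring.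
Qed.

(** * Consistency of the estimator *)

Lemma mle_consistent (theta : R) : t k @[k --> \oo] --> +oo ->
  let theta_hat N := mle P t N B (fun s w => theta * s + B1 s w + B2 s w) in
  cvg_in_L2 P theta_hat (cst theta) /\ cvg_as P theta_hat (cst theta).
Proof.
move=> t_cvg theta_hat.
have [c cP] := choice (blue_exists theta).
(* [Y n] is the error for the [n + 1] times [t 0], ..., [t n]; the shift of index is undone by
   [cvg_shiftS]. *)
pose Y n := comb n.+1 (c n); pose v n := sp P (Y n) (Y n).
have YE n w : theta_hat n.+1 w = theta + Y n w by have [+ _ _ _] := cP n; exact.
have c_out n i : (n < i)%N -> c n i = 0 by have [_ + _ _] := cP n; exact.
have cG n : \sum_(i < n.+1) c n i * G i = 1 by have [] := cP n.
have YD n j : (j <= n)%N -> sp P (Y n) (D j) = v n * G j.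
  by have [_ _ _] := cP n; exact.
have Y_L2 n : Y n \in Lfun P 2%:E by exact: comb_L2.
have v0 n : 0 <= v n by exact: sp_ge0.
have YY m n : (m <= n)%N -> sp P (Y n) (Y m) = v n.
  move=> mn; rewrite /Y sp_combr// -/(Y n) -[RHS]mulr1 -(cG m) mulr_sumr.
  apply: eq_bigr => i _; rewrite YD; first by ring.
  by rewrite (leq_trans _ mn)// -ltnS.
(* The difference is again one combination of increments, so [comb_pow4] will bound its fourth
   moment. *)
have Ydiff m n : (m <= n)%N ->
    (fun w => Y n w - Y m w) = comb n.+1 (fun i => c n i - c m i).
  move=> mn; apply/funext => w; rewrite /Y /comb.
  rewrite (big_ord_widen n.+1 (fun i => c m i * D i w))//.
  rewrite [X in _ - X]big_mkcond -sumrB.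
  apply: eq_bigr => i _; case: ifPn => im; first by rewrite mulrBl.
  by rewrite (c_out m i) ?subr0// ltnNge -ltnS.
have spdiff m n : (m <= n)%N ->
    sp P (fun w => Y n w - Y m w) (fun w => Y n w - Y m w) = v m - v n.
  move=> mn.
  have -> : (fun w => Y n w - Y m w) = fun w => 1 * Y n w + (-1) * Y m w.
    by apply/funext => w; ring.
  by rewrite sp_sqrD// (YY m n mn) -/(v m) -/(v n); ring.
have v_decr m n : (m <= n)%N -> v n <= v m.
  by move=> mn; rewrite -subr_ge0 -spdiff// sp_ge0.
(* The variance of the unbiased estimator [B_(t_n) / t_n] dominates [v n]. *)
have v_le n : v n <= t n `^ (- (2 - 2 * H1)) + t n `^ (- (2 - 2 * H2)).
  pose one (_ : nat) : R := 1.
  have ZE : comb n.+1 one = fun w => 1 * B1 (t n) w + 1 * B2 (t n) w.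
    apply/funext => w; rewrite /comb; under eq_bigr do rewrite mul1r.
    by rewrite sum_increment /B !mul1r.
  have ZZ : sp P (comb n.+1 one) (comb n.+1 one) =
      t n `^ (2 * H1) + t n `^ (2 * H2).
    rewrite ZE sp_sqrD// sp12 (fBm_sp P H1)// (fBm_sp P H2)//.
    rewrite subrr normr0 !powR0; [by lra| |].
      by have /andP[? _] := H2_range; rewrite gt_eqF//; lra.
    by have /andP[? _] := H1_range; rewrite gt_eqF//; lra.
  have YZ : sp P (Y n) (comb n.+1 one) = v n * t n.
    rewrite sp_combr// -[in RHS](sum_increment t id n) mulr_sumr.
    by apply: eq_bigr => i _; rewrite mul1r YD// -ltnS.
  (* In [E((Y_n - B_(t_n) / t_n)^2) >= 0] the cross term is [-2 v_n], which leaves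
     [v_n <= E(B_(t_n)^2) / t_n^2]. *)
  have := sp_ge0 P (fun w => 1 * Y n w + (- (t n)^-1) * comb n.+1 one w).
  rewrite sp_sqrD// YZ ZZ -/(v n).
  have tn := t_gt0 n; have tn0 : t n != 0 by rewrite gt_eqF.
  have E h : t n `^ (- (2 - 2 * h)) = (- (t n)^-1) ^+ 2 * t n `^ (2 * h).
    rewrite opprB powRD; last by rewrite tn0 implybT.
    by rewrite powRN powR_mulrn ?ltW// sqrrN exprVn mulrC.
  rewrite !E -mulrDr.
  rewrite (_ : 2 * 1 * - (t n)^-1 * (v n * t n) = - 2 * v n); last by field.
  lra.
have v_cvg : v n @[n --> \oo] --> 0.
  have /andP[_ H11] := H1_range; have /andP[_ H21] := H2_range.
  have h1 : 0 < 2 - 2 * H1 by lra.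
  have h2 : 0 < 2 - 2 * H2 by lra.
  apply: (@squeeze_cvgr _ _ _ _ (cst 0)
    (fun n => t n `^ (- (2 - 2 * H1)) + t n `^ (- (2 - 2 * H2)))).
  - by apply: nearW => n; rewrite v0 v_le.
  - exact: cvg_cst.
  - by rewrite -[X in _ --> X]addr0; apply: cvgD; exact: powRN_cvg0.
have mY n : measurable_fun [set: T] (Y n).
  by have := Y_L2 n; rewrite inE => /andP[]; rewrite inE.
have thetaE n : theta_hat n.+1 = fun w => theta * cst 1 w + 1 * Y n w.
  by apply/funext => w; rewrite YE /= mulr1 mul1r.
split.
  split; last 2 first.
  - exact: Lfun_cst.
  - rewrite -cvg_shiftS /=.
    rewrite (_ : (fun n => _) = fun n => (v n)%:E).
      by apply: cvg_EFin => //; exact: nearW.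
    apply/funext => n; rewrite -sp_EFin//; congr expectation.
    by apply/funext => w /=; rewrite YE addrC addKr expr2.
  case=> [|n]; last by rewrite thetaE; apply: Lfun2D => //; exact: Lfun_cst.
  (* Without observations the numerator is an empty sum. *)
  rewrite (_ : theta_hat 0%N = cst 0); first exact: Lfun_cst.
  by apply/funext => w; rewrite /theta_hat /mle mxE big_ord0 mul0r.
have Y4 n (x : nat -> R) : (\int[P]_w ((comb n x w) ^+ 4)%:E <=
  (8 * 210 ^+ 2 * (sp P (comb n x) (comb n x)) ^+ 2)%:E)%E by exact: comb_pow4.
have C0 : 0 <= 8 * 210 ^+ 2 :> R by rewrite mulr_ge0// exprn_ge0.
have incr4 m n : (m <= n)%N -> (\int[P]_w ((Y n w - Y m w) ^+ 4)%:E <=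
    (8 * 210 ^+ 2 * (v m - v n) ^+ 2)%:E)%E.
  move=> mn; have := Y4 n.+1 (fun i => c n i - c m i).
  by rewrite -Ydiff// spdiff.
have := ae_cvg0_of_incr4 P Y v _ mY C0 v_decr incr4 v0
  (fun n => Y4 n.+1 (c n)) v_cvg.
apply: filterS => w Yw; rewrite -cvg_shiftS /=.
under eq_fun do rewrite YE.
have : theta + Y n w @[n --> \oo] --> theta + 0.
  by apply: cvgD => //; exact: cvg_cst.
by rewrite addr0.
Qed.

End drift_estimation.

Theorem theorem5 (R : realType) (d : measure_display) (T : measurableType d)
    (P : probability T R) (H1 H2 : R) (B1 B2 : R -> {RV P >-> R})
    (theta : R) (t : nat -> R) :
  2^-1 < H1 < 1 -> 2^-1 < H2 < 1 ->
  fBm P H1 B1 -> fBm P H2 B2 -> independent_processes P B1 B2 ->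
  (forall k, 0 < t k) -> (forall k, t k < t k.+1) ->
  t k @[k --> \oo] --> +oo ->
  let B := fun (s : R) (w : T) => B1 s w + B2 s w in
  let X := fun (s : R) (w : T) => theta * s + B1 s w + B2 s w in
  let theta_hat := fun N : nat => mle P t N B X in
  cvg_in_L2 P theta_hat (cst theta) /\ cvg_as P theta_hat (cst theta).
Proof.
move=> H1r H2r fBm1 fBm2 ind t_gt0 t_lt t_cvg B X theta_hat.
exact: (mle_consistent P H1 H2).
Qed.
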